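(* Let $\alpha\in\mathbb{Z}_{\ge0}^m$, $\beta\in\mathbb{Z}_{\ge0}^n$, and let $T:\mathbb{R}[x]_{\le\alpha}\to\mathbb{R}[y]_{\le\beta}$ be a linear operator whose symbol $\mathrm{sym}(T)$ is Lorentzian. Let $f\in\mathbb{R}[x]_{\le\alpha}$ be a Lorentzian polynomial such that $T(f)\ne0$. Let $P$, $Q$, $\mathscr{C}$ be the polymatroids whose sets of bases are the supports of $f$, $T(f)$ and $\mathrm{sym}(T)$, respectively; these have natural cages $\alpha$, $\beta$ and $(\alpha,\beta)$, respectively. Let $\mathscr{C}_*$ be the polymatroid correspondence induced by $(\mathscr{C},(\alpha,\beta))$. Then, as caged polymatroids, $$(Q,\beta)=(\mathscr{C}_*(P),\beta).$$
   Context: Symbols: $x=(x_1,\dots,x_m)$, $y=(y_1,\dots,y_n)$; $\mathbb{R}[x]_{\le\alpha}$ is the span of the monomials $x^\gamma$ with $\gamma\le\alpha$ componentwise, and similarly for $y$. Put $x^{[\gamma]}=\prod_i x_i^{\gamma_i}/\gamma_i!$. The symbol of $T$ is $\mathrm{sym}(T)=\sum_{\gamma\le\alpha}T(x^{[\gamma]})\,x^{[\alpha-\gamma]}\in\mathbb{R}[x,y]_{\le(\alpha,\beta)}$. The support of a polynomial is the set of exponent vectors of monomials with nonzero coefficient. Polymatroids: a polymatroid $P$ on a finite set $E$ is given by a rank function $\mathrm{rk}:2^E\to\mathbb{Z}_{\ge0}$ that is normalized ($\mathrm{rk}(\emptyset)=0$), increasing and submodular. Its set of bases $\mathcal{B}_P$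 consists of the $\delta\in\mathbb{Z}_{\ge0}^E$ with $\sum_{i\in E}\delta_i=\mathrm{rk}(E)$ and $\sum_{i\in A}\delta_i\le\mathrm{rk}(A)$ for all $A\subsetneq E$; $P$ is determined by $\mathcal{B}_P$, and the sets $\mathcal{B}_P$ are exactly the M-convex sets (nonempty subsets of some $\{\gamma\in\mathbb{Z}_{\ge0}^E:\sum\gamma_i=r\}$ satisfying: for all $u,v$ in the set and $i$ with $u_i<v_i$ there is $j$ with $u_j>v_j$ such that $u-e_j+e_i$ and $v-e_i+e_j$ are in the set). A cage for $P$ is $\alpha\in\mathbb{Z}_{\ge0}^E$ with $\mathrm{rk}(\{i\})\le\alpha_i$ for all $i$. Deletion $P\setminus D$ is restriction of the rank function to subsets of $E\setminus D$; the direct sum has rank function the sum of the rank functions. $\mathbf{B}_\beta$ is the polymatroid with $\mathrm{rk}(S)=\sum_{i\in S}\beta_i$. Polymatroid intersection: for two polymatroids $P,Q$ with the same cage $\alpha$, $P\wedge_\alpha Q$ is the polymatroid whose bases are the componentwise-minimal elements of $\{\beta_P\cap_\alpha\beta_Q:\beta_P\in\mathcal{B}_P,\beta_Q\in\mathcal{B}_Q\}$, where $(\delta\cap_\alpha\gamma)_i=\max\{\delta_i+\gamma_i-\alpha_i,0\}$ (these are known to form an M-convex set). Polymatroid correspondence: with $E_1=\{1,\dots,m\}$ (indexing the $x$-variables) and $E_2=\{m+1,\dots,m+n\}$ (indexing the $y$-variables), and $(\mathscr{C},(\alpha,\beta))$ a caged polymatroid on $E_1\cup E_2$, $\mathscr{C}_*(P):=\big((P\oplus\mathbf{B}_\beta)\wedge_{(\alpha,\beta)}\mathscr{C}\big)\setminus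 E_1$ for $P$ a polymatroid on $E_1$ with cage $\alpha$; it is a polymatroid on $E_2$ with cage $\beta$. Lorentzian polynomials (Brändén–Huh): a nonzero homogeneous polynomial of degree $d$ with nonnegative real coefficients is Lorentzian if its support is M-convex and, when $d\ge2$, every iterated partial derivative of order $d-2$ is a quadratic form whose Hessian has at most one positive eigenvalue. It is known (Brändén–Huh) that if $\mathrm{sym}(T)$ is Lorentzian and $f$ is Lorentzian with $T(f)\neq 0$, then $T(f)$ is Lorentzian; hence the supports of $f$, $T(f)$ and $\mathrm{sym}(T)$ are sets of bases of polymatroids. *)

(* Defs.v *)
From HB Require Import structures.
From mathcomp Require Import all_boot all_order all_algebra.
From mathcomp Require Import reals.
From mathcomp Require classical_sets.
From mathcomp Require Import mpoly.

Set Implicit Arguments.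
Unset Strict Implicit.
Unset Printing Implicit Defensive.

Import GRing.Theory Num.Theory.

(* Exponent vectors, bases and cages indexed by {0, ..., n-1} all live in
   'X_{1..n}; (_ <= _)%MM is the componentwise order and (_ - _)%MM the
   componentwise truncated subtraction. *)

Section Polymatroids.
Local Open Scope nat_scope.

Definition polymatroid_axiom (n : nat) (r : {ffun {set 'I_n} -> nat}) : bool :=
  [&& r set0 == 0,
      [forall A : {set 'I_n}, forall B : {set 'I_n},
        (A \subset B) ==> (r A <= r B)]
    & [forall A : {set 'I_n}, forall B : {set 'I_n},
        r (A :|: B) + r (A :&: B) <= r A + r B]].

Record polymatroid (n : nat) := Polymatroid {
  rk :> {ffun {set 'I_n} -> nat};
  rkP : polymatroid_axiom rk }.

HB.instance Definition _ n := [isSub for @rk n].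
HB.instance Definition _ n := [Choice of polymatroid n by <:].

Definition bases n (P : polymatroid n) : {pred 'X_{1..n}} :=
  [pred d : 'X_{1..n} | (\sum_(i < n) d i == P [set: 'I_n]) &&
    [forall A : {set 'I_n},
      (A \proper [set: 'I_n]) ==> (\sum_(i in A) d i <= P A)]].

Definition is_cage n (a : 'X_{1..n}) (P : polymatroid n) : bool :=
  [forall i, P [set i] <= a i].

Lemma polymatroidP n (r : {ffun {set 'I_n} -> nat}) :
  r set0 = 0 ->
  (forall A B : {set 'I_n}, A \subset B -> r A <= r B) ->
  (forall A B, r (A :|: B) + r (A :&: B) <= r A + r B) ->
  polymatroid_axiom r.
Proof.
move=> r0 rS rU; apply/and3P; split; first exact/eqP.
- by apply/forallP=> A; apply/forallP=> B; apply/implyP; exact: rS.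
- by apply/forallP=> A; apply/forallP=> B; exact: rU.
Qed.

Lemma rk0 n (P : polymatroid n) : P set0 = 0.
Proof. by case/and3P: (rkP P) => /eqP. Qed.

Lemma rkS n (P : polymatroid n) (A B : {set 'I_n}) :
  A \subset B -> P A <= P B.
Proof. by case/and3P: (rkP P) => _ /forallP/(_ A)/forallP/(_ B)/implyP. Qed.

Lemma rkUI n (P : polymatroid n) (A B : {set 'I_n}) :
  P (A :|: B) + P (A :&: B) <= P A + P B.
Proof. by case/and3P: (rkP P) => _ _ /forallP/(_ A)/forallP/(_ B). Qed.

Definition box_rk n (b : 'X_{1..n}) : {ffun {set 'I_n} -> nat} :=
  [ffun A : {set 'I_n} => \sum_(i in A) b i].

Lemma box_rkP n (b : 'X_{1..n}) : polymatroid_axiom (box_rk b).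
Proof.
apply: polymatroidP => [|A B sAB|A B]; rewrite !ffunE ?big_set0 //.
  by rewrite [leqRHS](big_setID A) /= (setIidPr sAB) leq_addr.
rewrite (big_setID A) /= setUK setDUl setDv set0U.
by rewrite [X in _ <= _ + X](big_setID A) /= setIC -addnA leq_add2l addnC.
Qed.

(* The polymatroid B_b. *)
Definition box_polymatroid n (b : 'X_{1..n}) := Polymatroid (box_rkP b).

(* Direct sum: the ground set 'I_m of P is the image of lshift in 'I_(m + n),
   and the ground set 'I_n of Q is the image of rshift. *)
Definition dsum_rk m n (P : polymatroid m) (Q : polymatroid n) :
    {ffun {set 'I_(m + n)} -> nat} :=
  [ffun A : {set 'I_(m + n)} =>
    P (@lshift m n @^-1: A) + Q (@rshift m n @^-1: A)].

Lemma dsum_rkP m n (P : polymatroid m) (Q : polymatroid n) :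
  polymatroid_axiom (dsum_rk P Q).
Proof.
apply: polymatroidP => [|A B sAB|A B]; rewrite !ffunE.
- by rewrite !preimset0 !rk0.
- by rewrite leq_add // rkS // preimsetS.
- by rewrite !preimsetU !preimsetI addnACA [leqRHS]addnACA leq_add // rkUI.
Qed.

Definition dsum m n (P : polymatroid m) (Q : polymatroid n) :=
  Polymatroid (dsum_rkP P Q).

(* Deletion of the first m elements of 'I_(m + n): the rank function is
   restricted to the subsets of the remaining n elements, which are identified
   with 'I_n by rshift. *)
Definition deletel_rk m n (P : polymatroid (m + n)) :
    {ffun {set 'I_n} -> nat} :=
  [ffun A : {set 'I_n} => P (@rshift m n @: A)].

Lemma deletel_rkP m n (P : polymatroid (m + n)) :
  polymatroid_axiom (deletel_rk P).
Proof.
apply: polymatroidP => [|A B sAB|A B]; rewrite !ffunE.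
- by rewrite imset0 rk0.
- by rewrite rkS // imsetS.
- rewrite imsetU imsetI ?rkUI // => x y _ _; exact: rshift_inj.
Qed.

Definition deletel m n (P : polymatroid (m + n)) := Polymatroid (deletel_rkP P).

(* The vectors d \cap_a g, for d a base of P and g a base of Q; truncated
   subtraction yields max (d i + g i - a i) 0. *)
Definition cap_vectors n (a : 'X_{1..n}) (P Q : polymatroid n)
    (e : 'X_{1..n}) : Prop :=
  exists d g : 'X_{1..n},
    [/\ d \in bases P, g \in bases Q & e = (d + g - a)%MM].

Definition minimal_vector n (S : 'X_{1..n} -> Prop) (e : 'X_{1..n}) : Prop :=
  S e /\ forall e', S e' -> (e' <= e)%MM -> e' = e.

(* The polymatroid whose set of bases is S. It is unique when it exists, that
   is, when S is M-convex; otherwise the value is the polymatroid of rank 0. *)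
Definition polymatroid_of_bases n (S : 'X_{1..n} -> Prop) : polymatroid n :=
  classical_sets.xget (box_polymatroid 0%MM)
    (fun W : polymatroid n => forall e, e \in bases W <-> S e).

Definition pm_meet n (a : 'X_{1..n}) (P Q : polymatroid n) : polymatroid n :=
  polymatroid_of_bases (minimal_vector (cap_vectors a P Q)).

Definition mcat m n (a : 'X_{1..m}) (b : 'X_{1..n}) : 'X_{1..m + n} :=
  [multinom match split i with inl j => a j | inr k => b k end | i < m + n].

Definition correspondence m n (C : polymatroid (m + n))
    (a : 'X_{1..m}) (b : 'X_{1..n}) (P : polymatroid m) : polymatroid n :=
  deletel (pm_meet (mcat a b) (dsum P (box_polymatroid b)) C).

Definition M_convex n (S : {pred 'X_{1..n}}) : Prop :=
  [/\ exists u, u \in S,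
      exists r, forall u, u \in S -> mdeg u = r
    & forall u v (i : 'I_n), u \in S -> v \in S -> u i < v i ->
        exists j : 'I_n, [/\ v j < u j,
          (u - U_(j) + U_(i))%MM \in S & (v - U_(i) + U_(j))%MM \in S]].

End Polymatroids.

Local Open Scope ring_scope.

Definition mpoly_le_pred (R : realType) n (a : 'X_{1..n}) :
    {pred {mpoly R[n]}} :=
  [pred p : {mpoly R[n]} | all (fun g => (g <= a)%MM) (msupp p)].

Lemma mpoly_le_submod (R : realType) n (a : 'X_{1..n}) :
  submod_closed (@mpoly_le_pred R n a).
Proof.
split; first by rewrite inE msupp0.
move=> c p q; rewrite !inE => /allP hp /allP hq; apply/allP=> g.
move/msuppD_le; rewrite mem_cat => /orP[/msuppZ_le/hp|/hq] //.
Qed.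

HB.instance Definition _ (R : realType) n (a : 'X_{1..n}) :=
  GRing.isSubmodClosed.Build R {mpoly R[n]} (@mpoly_le_pred R n a)
    (@mpoly_le_submod R n a).

(* R[x]_{<= a}, as an R-module. *)
Record mpoly_le (R : realType) n (a : 'X_{1..n}) := MpolyLe {
  mpoly_le_val :> {mpoly R[n]};
  mpoly_le_valP : mpoly_le_val \in @mpoly_le_pred R n a }.

HB.instance Definition _ (R : realType) n (a : 'X_{1..n}) :=
  [isSub for @mpoly_le_val R n a].
HB.instance Definition _ (R : realType) n (a : 'X_{1..n}) :=
  [Choice of mpoly_le R a by <:].
HB.instance Definition _ (R : realType) n (a : 'X_{1..n}) :=
  [SubChoice_isSubLmodule of mpoly_le R a by <:].

Definition divpow (R : realType) n (g : 'X_{1..n}) : {mpoly R[n]} :=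
  ((\prod_(i < n) (g i)`!)%N%:R)^-1 *: 'X_[g].

Lemma divpow_le (R : realType) n (a g : 'X_{1..n}) :
  (g <= a)%MM -> divpow R g \in @mpoly_le_pred R n a.
Proof.
move=> le_ga; rewrite inE; apply/allP=> h /msuppZ_le.
by rewrite msuppX inE => /eqP->.
Qed.

(* The variables x are the first m variables of {mpoly R[m + n]} and y the
   last n ones. For g <= a, the term insubd 0 (divpow R g) is divpow R g seen
   in R[x]_{<= a}. *)
Definition in_x (R : realType) m n (p : {mpoly R[m]}) : {mpoly R[m + n]} :=
  p \mPo [tuple 'X_(lshift n i) | i < m].

Definition in_y (R : realType) m n (q : {mpoly R[n]}) : {mpoly R[m + n]} :=
  q \mPo [tuple 'X_(rshift m j) | j < n].

Definition sym (R : realType) m n (a : 'X_{1..m}) (b : 'X_{1..n})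
    (T : {linear mpoly_le R a -> mpoly_le R b}) : {mpoly R[m + n]} :=
  \sum_(g : 'X_{1..m < (mdeg a).+1} | (g <= a)%MM)
    in_y m (T (insubd (0 : mpoly_le R a) (divpow R g)))
    * in_x n (divpow R (a - g)%MM).

(* The second-order partial derivatives of a quadratic form are constants,
   which are read off as the coefficients of the monomial 1. *)
Definition hessian (R : realType) n (q : {mpoly R[n]}) : 'M[R]_n :=
  \matrix_(i, j) ((q^`M(i))^`M(j))@_0%MM.

(* Eigenvalues are counted with multiplicity. *)
Definition at_most_one_pos_eigenvalue (R : realType) n (H : 'M[R]_n) : Prop :=
  forall s : seq R, all (fun l => 0 < l) s ->
    \prod_(l <- s) ('X - l%:P) %| char_poly H -> (size s <= 1)%N.

Definition lorentzian (R : realType) n (p : {mpoly R[n]}) : Prop :=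
  p != 0 /\
  exists d : nat,
    [/\ p \is d.-homog,
        forall g : 'X_{1..n}, 0 <= p@_g,
        M_convex (mem (msupp p))
      & (2 <= d)%N -> forall g : 'X_{1..n}, mdeg g = (d - 2)%N ->
          at_most_one_pos_eigenvalue (hessian p^`M[g])].

(* Main.v *)
Require Import Defs.
From HB Require Import structures.
From mathcomp Require Import all_boot all_order all_algebra.
From mathcomp Require Import reals.
From mathcomp Require Import mpoly.
From mathcomp Require Import zify.
From mathcomp Require boolp classical_sets.

(** Write [supp] for the support of a polynomial. All coefficients of [f] and of
    [sym T] are nonnegative, so nothing cancels in [T f], and
    [supp (T f)] consists of the [c] such that [(alpha - d, c)] lies in
    [supp (sym T)] for some [d] in [supp f] ([msupp_image]). It remains to see
    that this set is the set of bases of the correspondence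
    ([bases_correspondence]); a polymatroid is determined by its bases
    ([bases_inj]), and the cage conditions can be read off from the bases as
    well ([cage_of_bases]).

    A vector of the form [d \cap g], with [d] a base of the direct sum of [P]
    with the box of [beta] and [g = (x, c)] a base of [C], is
    [((d + x - alpha)^+, c)]. All [d] have the same degree and so have all
    [(x, c)], which bounds the degree of such a vector below by the degree of
    [c0], for any [c0] in the set above; equality holds at [(0, c0)]. So the
    minimal vectors whose first component vanishes are exactly the [(0, c)]
    with [c] in the set above: there [x <= alpha - d], and comparing degrees
    gives [x = alpha - d]. As the full rank is attained on the second group of
    coordinates, these vectors give the bases of the deletion
    ([bases_deletel]).

    This uses that the minimal vectors are the bases of a polymatroid
    ([bases_pm_meet]). The proof runs through a one-sided form of M-convexity,
    [exchange], in which only one of the two vectors moves. It passes to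
    Minkowski sums ([exchange_msum]), and from a set [S] to the minimal vectors
    of the truncations [(s - a)^+], which moreover all have the same degree
    ([leq_mdeg_minimal_truncation], [minimal_truncation_exchange]). Conversely
    a nonempty set of vectors of constant degree with this property is the set
    of bases of the polymatroid whose rank function is
    [A |-> max_(s in S) s(A)] ([bases_of_exchange]). *)

Set Implicit Arguments.
Unset Strict Implicit.
Unset Printing Implicit Defensive.

Import Order.TTheory GRing.Theory Num.Theory.

Local Notation wt s A := (\sum_(k in A) s%MM k).

(** * Degrees and sums of exponent vectors *)

Lemma mdeg_le_eq n (d e : 'X_{1..n}) :
  (d <= e)%MM -> mdeg e <= mdeg d -> d = e.
Proof.
move=> le_de; rewrite -{1}(submK le_de) mdegD => le_deg.
have /eqP : mdeg (e - d)%MM == 0 by lia.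
by move/eqP; rewrite mdeg_eq0 => /eqP ed0; rewrite -(submK le_de) ed0 add0m.
Qed.

Lemma leq_mdegB n (d e : 'X_{1..n}) : mdeg d <= mdeg (d - e)%MM + mdeg e.
Proof. by rewrite -mdegD !mdegE leq_sum // => i _; rewrite mnmDE mnmBE; lia. Qed.

Lemma mdegB n (d e : 'X_{1..n}) : (e <= d)%MM -> mdeg (d - e)%MM + mdeg e = mdeg d.
Proof. by move=> le_ed; rewrite -mdegD submK. Qed.

Lemma ltn_sum_at (I : finType) (F G : I -> nat) (i0 : I) :
  (forall x, F x <= G x) -> F i0 < G i0 -> \sum_x F x < \sum_x G x.
Proof.
move=> leFG ltFG; rewrite (bigD1 i0) //= [ltnRHS](bigD1 i0) //=.
by rewrite -addSn leq_add // leq_sum.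
Qed.

Section Exchange.
Variable n : nat.
Implicit Types (s t u v a e d : 'X_{1..n}) (A B : {set 'I_n}) (i j k : 'I_n).
Implicit Type S : 'X_{1..n} -> Prop.

Lemma wtT s : wt s [set: 'I_n] = mdeg s.
Proof. by rewrite mdegE; apply: eq_bigl => k; rewrite inE. Qed.

Lemma wtD s t A : wt (s + t) A = wt s A + wt t A.
Proof. by rewrite -big_split; apply: eq_bigr => k _; rewrite mnmDE. Qed.

Lemma wt1 i A : wt U_(i) A = (i \in A).
Proof.
under eq_bigr do rewrite mnm1E.
case: (boolP (i \in A)) => iA.
  by rewrite (bigD1 i) //= eqxx big1 // => k /andP[_ /negPf]; rewrite eq_sym => ->.
by rewrite big1 // => k kA; case: eqP => // ik; rewrite ik kA in iA.
Qed.

Definition transfer i j s : 'X_{1..n} := (s - U_(i) + U_(j))%MM.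

Lemma transferE i j s k : transfer i j s k = s k - (i == k) + (j == k).
Proof. by rewrite mnmDE mnmBE !mnm1E. Qed.

Lemma wt_transfer i j s A :
  0 < s i -> wt (transfer i j s) A + (i \in A) = wt s A + (j \in A).
Proof.
move=> si; have def_s : s = (s - U_(i) + U_(i))%MM.
  apply/mnmP=> k; rewrite mnmDE mnmBE mnm1E; case: eqP => [<-|_]; lia.
by rewrite [in RHS]def_s /transfer !wtD !wt1 addnAC.
Qed.

Definition dist s t := \sum_k ((s k - t k) + (t k - s k)).

(** The descent behind all exchange arguments below: an exchange towards [t]
    decreases the l1-distance to [t]. *)
Lemma dist_transfer s t i j :
  t i < s i -> s j < t j -> dist (transfer i j s) t < dist s t.
Proof.
move=> lti ltj; apply: (ltn_sum_at (i0 := i)) => [k|]; rewrite !transferE.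
  by case: eqP => [<-|_]; case: eqP => [jk|_]; subst; lia.
by rewrite eqxx; case: eqP => [jk|_]; subst; lia.
Qed.

Lemma exists_lt_of_wt_lt s t A :
  wt s A < wt t A -> exists2 k, k \in A & s k < t k.
Proof.
move=> lt_st; have /existsP[k /andP[]] : [exists k, (k \in A) && (s k < t k)];
  last by exists k.
apply: contraLR lt_st; rewrite negb_exists => /forallP h.
by rewrite -leqNgt; apply: leq_sum => k kA; move: (h k); rewrite kA /= -leqNgt.
Qed.

(** * The one-sided exchange property *)

(** The half of the M-convexity axiom in which only the first vector moves. *)
Definition exchange S := forall s t i, S s -> S t -> t i < s i ->
  exists2 j, s j < t j & S (transfer i j s).

Definition equidegree S r := forall s, S s -> mdeg s = r.

(** The Minkowski sum. *)
Definition msum S1 S2 : 'X_{1..n} -> Prop :=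
  fun s => exists d g, [/\ S1 d, S2 g & s = (d + g)%MM].

Lemma transfer_comp i k j s : 0 < s i ->
  transfer k j (transfer i k s) = transfer i j s.
Proof.
move=> si; apply/mnmP=> l; rewrite !transferE.
by case: (i =P l) => [<-|_]; case: (k =P _); case: (j =P _); lia.
Qed.

(** Exchange in one of the summands at [i], towards the summands of [t]. This
    brings in a unit at some [k]. If [t] does not ask for it there, then
    the current sum exceeds [t] at [k], so one of its two summands exceeds the
    corresponding summand of [t] at [k] and can pass the surplus on. Each step
    brings the pair of summands closer to those of [t], so the walk of the
    surplus stops. *)
Lemma exchange_msum S1 S2 :
  exchange S1 -> exchange S2 -> exchange (msum S1 S2).
Proof.
move=> ex1 ex2 s t i [d0 [g0 [S1d0 S2g0 def_s]]] [d' [g' [S1d' S2g' def_t]]].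
move=> lti.
(* The surplus sits at k. *)
have walk N : forall k d g, dist d d' + dist g g' < N -> S1 d -> S2 g ->
    (d + g)%MM = transfer i k s -> t k < (d + g)%MM k ->
  exists2 j, s j < t j & msum S1 S2 (transfer i j s).
  elim: N => // N IH k d g ltN S1d S2g def_dg ltk.
  have finish j d1 g1 : S1 d1 -> S2 g1 -> dist d1 d' + dist g1 g' < N ->
      (d1 + g1)%MM = transfer k j (d + g)%MM ->
      exists2 j, s j < t j & msum S1 S2 (transfer i j s).
    rewrite def_dg transfer_comp; last by lia.
    move=> S1d1 S2g1 ltN1 def1; case: (ltnP (s j) (t j)) => [ltj|gej].
      by exists j => //; exists d1, g1.
    apply: (IH j d1 g1) => //; rewrite def1 transferE eqxx.
    by case: eqP => [eij|]; subst; lia.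
  have [ltd|ged] := ltnP (d' k) (d k).
    have [j ltj S1j] := ex1 d d' k S1d S1d' ltd.
    apply: (finish j (transfer k j d) g) => //.
      by have := dist_transfer ltd ltj; lia.
    by apply/mnmP=> l; rewrite !(transferE, mnmDE); case: (k =P l) => [<-|]; lia.
  have ltg : g' k < g k by move: ltk; rewrite def_t !mnmDE; lia.
  have [j ltj S2j] := ex2 g g' k S2g S2g' ltg.
  apply: (finish j d (transfer k j g)) => //.
    by have := dist_transfer ltg ltj; lia.
  by apply/mnmP=> l; rewrite !(transferE, mnmDE); case: (k =P l) => [<-|]; lia.
(* The walk starts at i, where s itself exceeds t. *)
apply: (walk _ i d0 g0 (ltnSn _)) => //; last by rewrite -def_s.
rewrite -def_s; apply/mnmP=> l; rewrite transferE; case: eqP => [<-|]; lia.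
Qed.

(** Subtraction is truncated, so these are the vectors [(s - a)^+]. *)
Definition truncation a S : 'X_{1..n} -> Prop :=
  fun e => exists2 s, S s & e = (s - a)%MM.

Lemma mdeg_transfer i j s : 0 < s i -> mdeg (transfer i j s) = mdeg s.
Proof.
by move=> si; have := wt_transfer j [set: 'I_n] si; rewrite !wtT !inE; lia.
Qed.

(** Suppose that [e = (s - a)^+] is minimal and [(t - a)^+] has smaller degree.
    Exchanging in [t] at a coordinate where [t] exceeds both [s] and [a] does
    not increase the degree of [(t - a)^+] and brings [t] closer to [s]; so
    assume that there is no such coordinate. Some [i] has [s i > t i] and
    [s i > a i]. Exchanging [s] at [i] then brings a unit to a coordinate where
    [s] is below [a], which makes [e] smaller at [i] and larger nowhere. *)
Lemma leq_mdeg_minimal_truncation a S e e' : exchange S ->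
  minimal_vector (truncation a S) e -> truncation a S e' -> mdeg e <= mdeg e'.
Proof.
move=> exS [[s Ss def_e] min_e] [t St ->] {e'}.
have [N] := ubnP (dist t s); elim: N t St => // N IH t St ltN.
rewrite leqNgt; apply/negP => lt_ts.
have [[j /andP[ltj gta]]|no_j] :=
    altP (@existsP _ (fun j => (s j < t j) && (a j < t j))).
  have [i lti S't] := exS t s j St Ss ltj.
  have := IH _ S't (leq_trans (dist_transfer ltj lti) ltN).
  rewrite leqNgt => /negP; apply; apply: leq_ltn_trans lt_ts.
  have tj : 0 < (t - a)%MM j by rewrite mnmBE; lia.
  rewrite -(mdeg_transfer i tj) !mdegE leq_sum // => k _.
  rewrite mnmBE !transferE mnmBE.
  by case: (j =P k) => [<-|_]; case: (i =P _) => _; lia.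
move: no_j; rewrite negb_exists => /forallP no_j.
have [i _ lti] : exists2 i, i \in [set: 'I_n] & (t - a)%MM i < (s - a)%MM i.
  by apply: exists_lt_of_wt_lt; rewrite !wtT -def_e.
rewrite !mnmBE in lti.
have [|j ltj S's] := exS s t i Ss St; first by lia.
have := no_j j; rewrite ltj /= -leqNgt => tja.
have le_e : ((transfer i j s - a)%MM <= e)%MM.
  apply/mnm_lepP=> k; rewrite def_e !mnmBE transferE.
  by case: (i =P k) => [<-|_]; case: (j =P _) => [<-|_]; lia.
have := min_e _ (ex_intro2 _ _ _ S's erefl) le_e.
move/mnmP/(_ i); rewrite def_e !mnmBE transferE eqxx.
by case: eqP => [eji|_]; subst; lia.
Qed.

(** The exchange in the untruncated set already works: if it raised [s] at a
    coordinate where [s] is below [a], then [e] would not be minimal; otherwise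
    truncation commutes with the exchange, and the new vector is minimal since
    it has the same degree as [e]. *)
Lemma minimal_truncation_exchange a S : exchange S ->
  exchange (minimal_vector (truncation a S)).
Proof.
move=> exS e e' i min_e min_e' lti.
have [[s Ss def_e] _] := min_e; have [[t St def_e'] _] := min_e'.
have [|j ltj S's] := exS s t i Ss St.
  by move: lti; rewrite def_e def_e' !mnmBE; lia.
have ei : 0 < e i by lia.
have min_of_mdeg u : truncation a S u -> mdeg u <= mdeg e ->
    minimal_vector (truncation a S) u.
  move=> Su leu; split=> // v Sv le_vu.
  apply: mdeg_le_eq le_vu _.
  exact: leq_trans leu (leq_mdeg_minimal_truncation exS min_e Sv).
have [ltja|geja] := ltnP (s j) (a j).
  have Su : truncation a S (transfer i j s - a)%MM by exists (transfer i j s).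
  have le_u : ((transfer i j s - a)%MM <= e)%MM.
    apply/mnm_lepP=> k; rewrite def_e !mnmBE transferE.
    by case: (i =P k) => [<-|_]; case: (j =P _) => [<-|_]; lia.
  have [_ /(_ _ Su le_u)] := min_e.
  move/mnmP/(_ i); move: ei; rewrite def_e !mnmBE transferE eqxx.
  by case: eqP => [eji|_]; subst; lia.
exists j; first by rewrite def_e def_e' !mnmBE; lia.
apply: min_of_mdeg; last by rewrite mdeg_transfer.
exists (transfer i j s) => //; apply/mnmP=> k.
rewrite mnmBE !transferE def_e mnmBE; move: ei; rewrite def_e mnmBE.
by case: (i =P k) => [<-|_]; case: (j =P _) => [<-|_]; lia.
Qed.

End Exchange.

Lemma exchange_M_convex n (S S' : {pred 'X_{1..n}}) :
  S =i S' -> M_convex S' -> exchange (fun s => s \in S).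
Proof.
move=> eqS [_ _ exS'] s t i; rewrite !eqS => Ss St lti.
have [j [ltj _ S's]] := exS' t s i St Ss lti; exists j => //.
by rewrite eqS; exact: S's.
Qed.

(** * Polymatroids and their bases *)

Section Bases.
Variable n : nat.
Implicit Types (s t u v a e d : 'X_{1..n}) (A B : {set 'I_n}) (i j k : 'I_n).
Implicit Type P Q : polymatroid n.

Lemma basesP P d :
  reflect (mdeg d = P [set: 'I_n] /\ forall A, wt d A <= P A) (d \in bases P).
Proof.
rewrite inE -[\sum_(i < n) _]mdegE.
apply: (iffP andP) => [[/eqP degd /forallP bd]|[degd bd]]; split=> //.
- move=> A; have [->|AT] := eqVneq A [set: 'I_n]; first by rewrite wtT degd.
  by move/implyP: (bd A); apply; rewrite properT.
- exact/eqP.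
- by apply/forallP=> A; apply/implyP.
Qed.

(** Only the coordinates of [d] in [A] matter: these are the bases of the
    restriction of [P] to [A]. *)
Definition tight P A d := wt d A = P A /\ forall B, B \subset A -> wt d B <= P B.

(** The greedy algorithm: a base of the restriction to [A] extends to one of the
    restriction to [i |: A] by giving [i] the marginal rank; a set [B]
    containing [i] stays within its rank by submodularity for [A] and [B]. *)
Lemma tight_extend P A A' d : A \subset A' -> tight P A d ->
  exists2 d', tight P A' d' & forall B, B \subset A -> wt d' B = wt d B.
Proof.
have [N] := ubnP #|A' :\: A|; elim: N A d => // N IH A d ltN sAA' tA.
have [/eqP|[i iD]] := set_0Vmem (A' :\: A).
  rewrite setD_eq0 => sA'A; exists d => //.
  by have -> : A' = A by apply/eqP; rewrite eqEsubset sA'A.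
have /setDP[iA' iA] := iD.
pose d1 := [multinom (if k == i then P (i |: A) - P A else d k) | k < n].
have d1E B : i \notin B -> wt d1 B = wt d B.
  move=> iB; apply: eq_bigr => k kB; rewrite mnmE; case: eqP => // ki.
  by rewrite -ki kB in iB.
have d1U B : i \in B -> wt d1 B = P (i |: A) - P A + wt d (B :\ i).
  by move=> iB; rewrite (big_setD1 i) //= mnmE eqxx d1E // !inE eqxx.
have [degA leA] := tA.
have leP : P A <= P (i |: A) by rewrite rkS // subsetUr.
have t1 : tight P (i |: A) d1.
  split=> [|B sB].
    rewrite d1U ?setU11 // setU1K // degA; lia.
  have [iB|iB] := boolP (i \in B); last first.
    by rewrite d1E // leA //; apply/subsetP=> k kB; have := subsetP sB k kB;
      rewrite !inE; case: eqP => // ki; rewrite -ki kB in iB.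
  have sBA : B :\ i \subset A by rewrite subDset.
  rewrite d1U //; have := rkUI P A B.
  have -> : A :|: B = i |: A.
    apply/setP=> k; have := subsetP sB k; rewrite !inE.
    case: (k =P i) => [->|_]; first by rewrite iB orbT.
    by case: (k \in B) => /=; [move=> -> | rewrite orbF].
  have -> : A :&: B = B :\ i.
    apply/setP=> k; have := subsetP sB k; rewrite !inE.
    case: (k =P i) => [->|_]; first by rewrite (negPf iA).
    by case: (k \in B) => /=; [move=> -> | rewrite andbF].
  by have := leA _ sBA; lia.
have [||d' td' d'E] := IH _ _ _ _ t1.
- rewrite -ltnS (leq_trans _ ltN) // ltnS [X in _ < X](cardsD1 i) iD.
  rewrite addnC addn1 ltnS; apply: subset_leq_card; apply/subsetP=> k.
  by rewrite !inE negb_or => /andP[/andP[-> ->] ->].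
- by rewrite subUset sub1set iA'.
exists d' => // B sB; rewrite d'E.
  by rewrite d1E //; apply: contra iA => /(subsetP sB).
by rewrite (subset_trans sB) ?subsetUr.
Qed.

(** Run the greedy algorithm on [A] first and on the other elements
    afterwards. *)
Lemma base_attaining_rk P A : exists2 d, d \in bases P & wt d A = P A.
Proof.
have t0 : tight P set0 0%MM.
  by split=> [|B]; [|rewrite subset0 => /eqP->]; rewrite big_set0 rk0.
have [d [degA leA] _] := tight_extend (sub0set A) t0.
have [d' [degT leT] d'E] := tight_extend (subsetT A) (conj degA leA).
exists d'; last by rewrite d'E.
by apply/basesP; split=> [|B]; [rewrite -wtT | rewrite leT ?subsetT].
Qed.

(** The rank of [A] is the maximum of [d(A)] over the bases [d]. *)
Lemma bases_inj P Q : bases P =i bases Q -> P = Q.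
Proof.
suff le P1 Q1 : bases P1 =i bases Q1 -> forall A, P1 A <= Q1 A.
  move=> eqPQ; apply/val_inj/ffunP=> A /=; apply/eqP.
  by rewrite eqn_leq !le // => d; rewrite eqPQ.
move=> eqPQ A; have [d] := base_attaining_rk P1 A.
by rewrite eqPQ => /basesP[_ leQ] <-.
Qed.

Lemma cage_of_bases P a : (forall d, d \in bases P -> (d <= a)%MM) -> is_cage a P.
Proof.
move=> le_a; apply/forallP=> i; have [d dP <-] := base_attaining_rk P [set i].
by rewrite big_set1; apply/mnm_lepP; exact: le_a.
Qed.

End Bases.

Section FromExchange.
Variables (n r : nat) (S : 'X_{1..n} -> Prop).
Hypotheses (S_exchange : exchange S) (S_mdeg : equidegree S r).
Implicit Types (s t u v a e d : 'X_{1..n}) (A B X Y : {set 'I_n}) (i j k : 'I_n).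

Lemma wt_le s A : S s -> wt s A <= r.
Proof.
by move=> Ss; rewrite -(S_mdeg Ss) -wtT [leqRHS](big_setID A) /= setTI leq_addr.
Qed.

(** The sums over [A] are at most [r], so the maximum may be taken over the
    values [c] that are attained. *)
Definition max_wt : {ffun {set 'I_n} -> nat} :=
  [ffun A : {set 'I_n} =>
    \max_(c < r.+1 | boolp.asbool (exists2 s, S s & wt s A = c)) c].

Lemma le_max_wt s A : S s -> wt s A <= max_wt A.
Proof.
move=> Ss; rewrite ffunE.
have ltr : wt s A < r.+1 by rewrite ltnS wt_le.
apply: (leq_bigmax_cond (Ordinal ltr)); apply/boolp.asboolP; by exists s.
Qed.

Lemma max_wt_attained s0 A : S s0 -> exists2 s, S s & wt s A = max_wt A.
Proof.
move=> Ss0; have ltr : wt s0 A < r.+1 by rewrite ltnS wt_le.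
pose p (c : 'I_r.+1) := boolp.asbool (exists2 s, S s & wt s A = c).
have [|c /boolp.asboolP[s Ss sA] def_c] :=
    @eq_bigmax_cond _ p (fun c : 'I_r.+1 => c : nat).
  by apply/card_gt0P; exists (Ordinal ltr); apply/boolp.asboolP; exists s0.
by exists s => //; rewrite sA -def_c ffunE.
Qed.

Lemma wtC s A : S s -> wt s A + wt s (~: A) = r.
Proof. by move=> Ss; rewrite -(S_mdeg Ss) -wtT [RHS](big_setID A) /= setTI setTD. Qed.

(** A vector that is maximal on [X] remains so after an exchange that removes a
    unit outside [Y], hence outside [X]. Such exchanges towards a vector that is
    maximal on [Y] are possible until the sum over [Y] is maximal too. *)
Lemma max_wt_chain s0 X Y : S s0 -> X \subset Y ->
  exists s, [/\ S s, wt s X = max_wt X & wt s Y = max_wt Y].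
Proof.
move=> Ss0 sXY; have [t St tY] := max_wt_attained Y Ss0.
have [s Ss sX] := max_wt_attained X Ss0.
have [N] := ubnP (dist s t); elim: N s Ss sX => // N IH s Ss sX ltN.
have [ltY|geY] := ltnP (wt s Y) (wt t Y); last first.
  by exists s; split=> //; apply/eqP; rewrite eqn_leq le_max_wt //= -tY.
have [i iY lti] : exists2 i, i \in ~: Y & t i < s i.
  by apply: exists_lt_of_wt_lt; have := wtC Y Ss; have := wtC Y St; lia.
have [j ltj S's] := S_exchange Ss St lti.
apply: (IH _ S's); last by have := dist_transfer lti ltj; lia.
apply/eqP; rewrite eqn_leq le_max_wt //= -sX.
have si : 0 < s i by lia.
have := wt_transfer j X si; have -> : i \in X = false.
  by apply: contraTF iY => /(subsetP sXY); rewrite inE negbK.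
by rewrite addn0 => ->; exact: leq_addr.
Qed.

Hypothesis S_inhabited : exists s, S s.

(** For submodularity, evaluate a vector that is maximal on both [A :&: B] and
    [A :|: B] on [A] and on [B]. *)
Lemma max_wt_polymatroid : polymatroid_axiom max_wt.
Proof.
have [s0 Ss0] := S_inhabited.
apply: polymatroidP => [|A B sAB|A B].
- by have [s _ <-] := max_wt_attained set0 Ss0; rewrite big_set0.
- have [s Ss <-] := max_wt_attained A Ss0.
  apply: leq_trans (le_max_wt B Ss).
  by rewrite [leqRHS](big_setID A) /= (setIidPr sAB) leq_addr.
have [|s [Ss sI sU]] := @max_wt_chain s0 (A :&: B) (A :|: B) Ss0.
  by rewrite subIset // subsetUl.
rewrite -sI -sU; have := le_max_wt A Ss; have := le_max_wt B Ss.
have -> : wt s B = wt s (A :&: B) + wt s ((A :|: B) :\: A).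
  by rewrite (big_setID A) /= setIC setDUl setDv set0U.
have -> : wt s (A :|: B) = wt s A + wt s ((A :|: B) :\: A).
  by rewrite (big_setID A) /= setUK.
lia.
Qed.

Definition polymatroid_of_exchange := Polymatroid max_wt_polymatroid.

(** Let [d] satisfy the rank inequalities, let [s] in [S] be as close as possible
    to [d], and suppose that [s j < d j]. Let [X] consist of [j] and of
    the [i] for which moving a unit of [s] from [i] to [j] stays in [S]. By the
    choice of [s], no [i] in [X] has [s i > d i], so [s(X) < d(X)] and
    some [t] in [S] has [t(X) > s(X)]. Take [t] closest to [s]; then [t] exceeds
    [s] only inside [X]. Exchanging [s] towards [t] at some [i] outside [X]
    therefore moves a unit to some [k] in [X]. Finally exchange the vector
    obtained from [s] by moving a unit from [k] to [j] towards the one obtained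
    by moving a unit from [i] to [k]: the only unit that can leave [i] goes to
    [k], which shows that [i] lies in [X], a contradiction. *)
Lemma bases_of_exchange d : d \in bases polymatroid_of_exchange <-> S d.
Proof.
have [s0 Ss0] := S_inhabited.
have max_wtT : max_wt [set: 'I_n] = r.
  by have [s Ss <-] := max_wt_attained [set: 'I_n] Ss0; rewrite wtT S_mdeg.
split=> [/basesP[/= degd led]|Sd]; last first.
  by apply/basesP; split=> [|A]; rewrite /= ?max_wtT ?le_max_wt // S_mdeg.
rewrite max_wtT in degd.
have [N] := ubnP (dist s0 d); elim: N s0 Ss0 => // N IH s Ss ltN.
have [->//|neq_ds] := eqVneq d s.
have [j ltj] : exists j, s j < d j.
  suff /existsP[j ltj] : [exists j, s j < d j] by exists j.
  apply: contraNT neq_ds; rewrite negb_exists => /forallP h.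
  have led_s : (d <= s)%MM by apply/mnm_lepP=> k; move: (h k); rewrite -leqNgt.
  have := S_mdeg Ss; rewrite -{1}(submK led_s) mdegD degd => /eqP.
  rewrite -{2}[r]add0n eqn_add2r mdeg_eq0 => /eqP sd0.
  by rewrite -(submK led_s) sd0 add0m.
have [[i [lti S'ij]]|no_i] :=
    boolp.pselect (exists i, d i < s i /\ S (transfer i j s)).
  by apply: (IH _ S'ij); have := dist_transfer lti ltj; lia.
pose X := [set i | (i == j) || (0 < s i) && boolp.asbool (S (transfer i j s))].
have jX : j \in X by rewrite inE eqxx.
have ltX : wt s X < wt d X.
  rewrite (bigD1 j) //= [ltnRHS](bigD1 j) //= -addSn leq_add // leq_sum // => i.
  rewrite inE => /andP[/orP[->//|/andP[_ /boolp.asboolP Sij]] _].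
  by rewrite leqNgt; apply/negP=> lti; apply: no_i; exists i.
have [t0 St0 t0X] := max_wt_attained X Ss.
have {t0X} ltXt0: wt s X < wt t0 X by rewrite t0X; exact: leq_trans ltX (led X).
exfalso; have [M] := ubnP (dist t0 s).
elim: M t0 St0 ltXt0 => // M IHt t St ltXt ltM.
(* Otherwise exchanging t at k would keep t(X) > s(X) and approach s. *)
have up_in_X k : s k < t k -> k \in X.
  move=> ltk; apply/contraT=> kX; have [i lti S't] := S_exchange St Ss ltk.
  case: (IHt _ S't); last by have := dist_transfer ltk lti; lia.
  have tk : 0 < t k by lia.
  by have := wt_transfer i X tk; rewrite (negPf kX) addn0 => ->; exact: ltn_addr.
have [i iX lti] : exists2 i, i \in ~: X & t i < s i.
  apply: exists_lt_of_wt_lt.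
  by rewrite -(ltn_add2l (wt s X)) wtC // -(wtC X St) ltn_add2r.
have [k ltk Sik] := S_exchange Ss St lti.
have si : 0 < s i by lia.
have S'ij : ~ S (transfer i j s).
  move=> Sij; move: iX; rewrite !inE si /= => /norP[_ /negP]; apply.
  exact/boolp.asboolP.
have kX := up_in_X k ltk.
have neq_kj : k != j by apply: contraPneq Sik => ->.
have neq_ki : k != i by apply: contraTneq iX => <-; rewrite in_setC kX.
have neq_ji : j != i by apply: contraTneq iX => <-; rewrite in_setC jX.
move: kX; rewrite inE (negPf neq_kj) => /andP[sk /boolp.asboolP Skj].
(* The only coordinate where the first vector is below the second is k. *)
have [|l] := S_exchange Skj Sik (i := i).
  by rewrite !transferE eqxx (negPf neq_ki); lia.
have [->|neq_kl] := eqVneq l k; last first.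
  by rewrite !transferE ![k == _]eq_sym (negPf neq_kl); lia.
move=> _ Sij; apply: S'ij; congr (S _): Sij; apply/mnmP=> h; rewrite !transferE.
have [<-|] := eqVneq k h.
  by rewrite ![_ == k]eq_sym (negPf neq_kj) (negPf neq_ki); lia.
by have [<-|] := eqVneq i h; rewrite ?(negPf neq_ji); lia.
Qed.

End FromExchange.

(** * Polymatroid intersection *)

Lemma minimal_vector_exists n (S : 'X_{1..n} -> Prop) e :
  S e -> exists e', minimal_vector S e'.
Proof.
have [N] := ubnP (mdeg e); elim: N e => // N IH e ltN Se.
have [[e' [Se' le_e' neq_e']]|no_smaller] :=
    boolp.pselect (exists e', [/\ S e', (e' <= e)%MM & e' <> e]).
  apply: (IH e') => //; rewrite ltnNge; apply/negP => geN; apply: neq_e'.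
  by apply: mdeg_le_eq => //; apply: leq_trans geN.
exists e; split=> // e' Se' le_e'.
by have [|neq_e'] := boolp.pselect (e' = e); last by case: no_smaller; exists e'.
Qed.

Lemma cap_vectorsE n (a : 'X_{1..n}) (P Q : polymatroid n) :
  cap_vectors a P Q =
  truncation a (msum (fun d => d \in bases P) (fun g => g \in bases Q)).
Proof.
apply: boolp.funext => e; apply: boolp.propext; split.
  by case=> d [g [dP gQ ->]]; exists (d + g)%MM => //; exists d, g.
by case=> _ [d [g [dP gQ ->]]] ->; exists d, g.
Qed.

Lemma bases_pm_meet n (a : 'X_{1..n}) (P Q : polymatroid n) :
  exchange (fun d => d \in bases P) -> exchange (fun g => g \in bases Q) ->
  forall e, e \in bases (pm_meet a P Q) <-> minimal_vector (cap_vectors a P Q) e.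
Proof.
move=> exP exQ; rewrite /pm_meet /polymatroid_of_bases cap_vectorsE.
set S := msum _ _; have exS : exchange S by exact: exchange_msum.
have [d dP _] := base_attaining_rk P set0.
have [g gQ _] := base_attaining_rk Q set0.
have [|e0 min_e0] := @minimal_vector_exists _ (truncation a S) (d + g - a)%MM.
  by exists (d + g)%MM => //; exists d, g.
have deg_min : equidegree (minimal_vector (truncation a S)) (mdeg e0).
  move=> e min_e; apply/eqP; rewrite eqn_leq.
  rewrite !(leq_mdeg_minimal_truncation (a := a) exS) //.
    by case: min_e.
  by case: min_e0.
have ex_min := minimal_truncation_exchange (a := a) exS.
have := @classical_sets.xgetPex _ (box_polymatroid 0%MM) (fun W : polymatroid n =>
  forall e, e \in bases W <-> minimal_vector (truncation a S) e).
apply; exists (polymatroid_of_exchange ex_min deg_min (ex_intro _ e0 min_e0)).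
exact: bases_of_exchange.
Qed.

(** * Exponent vectors in two groups of variables *)

Section Mcat.
Variables m n : nat.
Implicit Types (a : 'X_{1..m}) (b : 'X_{1..n}) (e : 'X_{1..m + n}).

Lemma mcat_lshift a b i : mcat a b (lshift n i) = a i.
Proof. by rewrite mnmE (unsplitK (inl i)). Qed.

Lemma mcat_rshift a b j : mcat a b (rshift m j) = b j.
Proof. by rewrite mnmE (unsplitK (inr j)). Qed.

Definition mcatE := (mcat_lshift, mcat_rshift).

Definition mleft e : 'X_{1..m} := [multinom e (lshift n i) | i < m].
Definition mright e : 'X_{1..n} := [multinom e (rshift m j) | j < n].

Lemma mcat_ext e e' : (forall i, e (lshift n i) = e' (lshift n i)) ->
  (forall j, e (rshift m j) = e' (rshift m j)) -> e = e'.
Proof.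
by move=> el er; apply/mnmP=> k; rewrite -(splitK k); case: split => ? /=.
Qed.

Lemma mcatK e : mcat (mleft e) (mright e) = e.
Proof. by apply: mcat_ext => i; rewrite mcatE mnmE. Qed.

Lemma mcat_inj a a' b b' : mcat a b = mcat a' b' -> a = a' /\ b = b'.
Proof.
move=> /mnmP eq_ab; split; apply/mnmP=> i.
  by have := eq_ab (lshift n i); rewrite !mcatE.
by have := eq_ab (rshift m i); rewrite !mcatE.
Qed.

Lemma mcatD a a' b b' : (mcat a b + mcat a' b')%MM = mcat (a + a') (b + b').
Proof. by apply: mcat_ext => i; rewrite mnmDE !mcatE mnmDE. Qed.

Lemma mcatB a a' b b' : (mcat a b - mcat a' b')%MM = mcat (a - a') (b - b').
Proof. by apply: mcat_ext => i; rewrite mnmBE !mcatE mnmBE. Qed.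

Lemma sum_mcat a b (A : {set 'I_(m + n)}) :
  \sum_(k in A) mcat a b k
  = \sum_(i in @lshift m n @^-1: A) a i + \sum_(j in @rshift m n @^-1: A) b j.
Proof.
rewrite big_split_ord /=.
by congr addn; apply: eq_big => i; rewrite ?inE // mcatE.
Qed.

Lemma mdeg_mcat a b : mdeg (mcat a b) = mdeg a + mdeg b.
Proof.
by rewrite -!wtT sum_mcat; congr addn; apply: eq_bigl => i; rewrite !inE.
Qed.

Lemma mcat_le a a' b b' :
  (mcat a b <= mcat a' b')%MM = (a <= a')%MM && (b <= b')%MM.
Proof.
apply/mnm_lepP/andP => [le_ab|[/mnm_lepP lea /mnm_lepP leb] k].
  split; apply/mnm_lepP=> i; first by have := le_ab (lshift n i); rewrite !mcatE.
  by have := le_ab (rshift m i); rewrite !mcatE.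
by rewrite -(splitK k); case: split => i; rewrite /= !mcatE.
Qed.

Lemma exchange_mcat (S : 'X_{1..m} -> Prop) b :
  exchange S -> exchange (fun e => exists2 s, S s & e = mcat s b).
Proof.
move=> exS _ _ k [s Ss ->] [t St ->].
rewrite -(splitK k); case: split => i /=; rewrite !mcatE ?ltnn // => lti.
have [j ltj S's] := exS s t i Ss St lti.
exists (lshift n j); first by rewrite !mcatE.
exists (transfer i j s) => //; apply: mcat_ext => l.
  by rewrite transferE !mcatE transferE !(inj_eq (@lshift_inj _ _)).
by rewrite transferE !mcatE !eq_lrshift; lia.
Qed.

End Mcat.

(** * The polymatroid correspondence *)

Section Correspondence.
Variables m n : nat.
Implicit Types (P : polymatroid m) (W C : polymatroid (m + n)).

Lemma bases_dsum_box P (b : 'X_{1..n}) e :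
  e \in bases (dsum P (box_polymatroid b)) <->
  exists2 d, d \in bases P & e = mcat d b.
Proof.
have preL (A : {set 'I_m}) : @lshift m n @^-1: (@lshift m n @: A) = A.
  by apply/setP=> i; rewrite inE mem_imset //; exact: lshift_inj.
have preRL (A : {set 'I_m}) : @rshift m n @^-1: (@lshift m n @: A) = set0.
  apply/setP=> i; rewrite !inE; apply/imsetP => -[j _ /eqP].
  by rewrite eq_rlshift.
have preR (A : {set 'I_n}) : @rshift m n @^-1: (@rshift m n @: A) = A.
  by apply/setP=> i; rewrite inE mem_imset //; exact: rshift_inj.
have preLR (A : {set 'I_n}) : @lshift m n @^-1: (@rshift m n @: A) = set0.
  apply/setP=> i; rewrite !inE; apply/imsetP => -[j _ /eqP].
  by rewrite eq_lrshift.
split=> [|[d /basesP[degd led] ->]]; last first.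
  apply/basesP; split=> [|A]; rewrite ffunE ffunE.
    by rewrite mdeg_mcat !preimsetT wtT degd.
  by rewrite sum_mcat leq_add2r.
rewrite -(mcatK e); move: (mleft e) (mright e) => d c /basesP[].
rewrite mdeg_mcat ffunE !preimsetT /= ffunE wtT => deg_dc le_dc.
have led (A : {set 'I_m}) : \sum_(i in A) d i <= P A.
  have := le_dc (@lshift m n @: A).
  by rewrite sum_mcat ffunE preL preRL big_set0 rk0 !addn0.
have lec (A : {set 'I_n}) : \sum_(i in A) c i <= \sum_(i in A) b i.
  have := le_dc (@rshift m n @: A).
  by rewrite sum_mcat !ffunE preR preLR big_set0 rk0 !add0n.
have lecb : (c <= b)%MM.
  by apply/mnm_lepP=> i; have := lec [set i]; rewrite !big_set1.
have ledT := led [set: 'I_m]; have lecT := lec [set: 'I_n]; rewrite !wtT in ledT lecT.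
exists d; first apply/basesP; first split=> //.
  by apply/eqP; rewrite eqn_leq ledT /= -(leq_add2r (mdeg b)) -deg_dc leq_add2l.
congr mcat; apply: mdeg_le_eq => //.
by rewrite -(leq_add2l (P [set: 'I_m])) -deg_dc leq_add2r.
Qed.

(** A base of [W] supported on the second group of coordinates shows that
    these coordinates have full rank, so that the deletion loses no degree. *)
Lemma bases_deletel W d0 : mcat 0%MM d0 \in bases W ->
  forall d, d \in bases (deletel W) <-> mcat 0%MM d \in bases W.
Proof.
move=> /basesP[deg0 le0] d.
have wt0 (c : 'X_{1..n}) (A : {set 'I_(m + n)}) :
    \sum_(k in A) mcat 0%MM c k = \sum_(j in @rshift m n @^-1: A) c j.
  by rewrite sum_mcat big1 // => i _; rewrite mnm0E.
have preR (A : {set 'I_n}) : @rshift m n @^-1: (@rshift m n @: A) = A.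
  by apply/setP=> i; rewrite inE mem_imset //; exact: rshift_inj.
have rkT : W (@rshift m n @: [set: 'I_n]) = W [set: 'I_(m + n)].
  apply/eqP; rewrite eqn_leq rkS ?subsetT //= -deg0 mdeg_mcat mdeg0 add0n.
  by have := le0 (@rshift m n @: [set: 'I_n]); rewrite wt0 preR wtT.
split=> /basesP[degd led]; apply/basesP; split=> [|A].
- by rewrite mdeg_mcat mdeg0 degd ffunE.
- rewrite wt0 (leq_trans (led _)) // ffunE rkS //.
  by apply/subsetP=> k /imsetP[j + ->]; rewrite inE.
- by rewrite ffunE rkT -degd mdeg_mcat mdeg0.
- by have := led (@rshift m n @: A); rewrite wt0 preR ffunE.
Qed.

Lemma bases_correspondence C P (a : 'X_{1..m}) (b : 'X_{1..n}) :
  exchange (fun d => d \in bases P) -> exchange (fun g => g \in bases C) ->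
  (forall d, d \in bases P -> (d <= a)%MM) ->
  (exists d c, d \in bases P /\ mcat (a - d) c \in bases C) ->
  forall c, c \in bases (correspondence C a b P) <->
    exists2 d, d \in bases P & mcat (a - d) c \in bases C.
Proof.
move=> exP exC leP [d0 [c0 [d0P c0C]]].
set D := dsum P (box_polymatroid b).
have exD : exchange (fun e => e \in bases D).
  move=> s t i /bases_dsum_box sD /bases_dsum_box tD lti.
  have [j ltj S's] := exchange_mcat exP sD tD lti.
  by exists j => //; apply/bases_dsum_box.
have meetP := bases_pm_meet (mcat a b) exD exC.
have degP d d' : d \in bases P -> d' \in bases P -> mdeg d = mdeg d'.
  by move=> /basesP[-> _] /basesP[-> _].
have degC g g' : g \in bases C -> g' \in bases C -> mdeg g = mdeg g'.
  by move=> /basesP[-> _] /basesP[-> _].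
have capP e : cap_vectors (mcat a b) D C e <-> exists d x c,
    [/\ d \in bases P, mcat x c \in bases C & e = mcat (d + x - a) c].
  split=> [[_ [g [/bases_dsum_box[d dP ->] gC ->]]]|[d [x [c [dP xcC ->]]]]].
    exists d, (mleft g), (mright g); rewrite mcatK; split=> //.
    by rewrite -{1}(mcatK g) mcatD mcatB [(b + _)%MM]addmC addmK.
  exists (mcat d b), (mcat x c); split=> //; first by apply/bases_dsum_box; exists d.
  by rewrite mcatD mcatB [(b + _)%MM]addmC addmK.
(* (d + x - a)^+ has degree at least |d| + |x| - |a|, and |d| and |x| + |c| do
   not depend on the choice of bases. *)
have cap_deg e : cap_vectors (mcat a b) D C e -> mdeg c0 <= mdeg e.
  move=> /capP[d [x [c [dP xcC ->]]]]; have := degC _ _ xcC c0C.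
  have := degP _ _ dP d0P; have := mdegB (leP _ d0P); have := leq_mdegB (d + x) a.
  rewrite mdegD !mdeg_mcat; lia.
have deg_c d c : d \in bases P -> mcat (a - d) c \in bases C -> mdeg c = mdeg c0.
  move=> dP dcC; have := degC _ _ dcC c0C; have := degP _ _ dP d0P.
  have := mdegB (leP _ dP); have := mdegB (leP _ d0P); rewrite !mdeg_mcat; lia.
have mem_meet c :
    mcat 0%MM c \in bases (pm_meet (mcat a b) D C) <->
    exists2 d, d \in bases P & mcat (a - d) c \in bases C.
  split=> [/meetP min_c|[d dP dcC]].
    have c0_cap : cap_vectors (mcat a b) D C (mcat 0%MM c0).
      apply/capP; exists d0, (a - d0)%MM, c0; split=> //.
      by rewrite addmC submK ?leP // -[X in (X - a)%MM]add0m addmK.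
    have := cap_deg _ min_c.1.
    have [] := (min_c, c0_cap); rewrite cap_vectorsE => min_c' c0_cap'.
    have := leq_mdeg_minimal_truncation (exchange_msum exD exC) min_c' c0_cap'.
    have [d [x [c1 [dP xc1C /mcat_inj[dxa0 eq_c1]]]]] := (capP _).1 min_c.1.
    rewrite -{c1}eq_c1 in xc1C.
    rewrite !mdeg_mcat mdeg0 !add0n => le_c ge_c; exists d => //.
    suff <- : x = (a - d)%MM by [].
    (* Vanishing of d + x - a truncated is x <= a - d; the degrees agree. *)
    apply: mdeg_le_eq.
      apply/mnm_lepP=> i; move/mnmP/(_ i): dxa0.
      by rewrite mnm0E !mnmBE mnmDE; lia.
    have := degC _ _ xc1C c0C; have := degP _ _ dP d0P.
    have := mdegB (leP _ dP); have := mdegB (leP _ d0P); rewrite !mdeg_mcat; lia.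
  apply/meetP; split=> [|e' /cap_deg le_e' e'_le].
    apply/capP; exists d, (a - d)%MM, c; split=> //.
    by rewrite addmC submK ?leP // -[X in (X - a)%MM]add0m addmK.
  by apply: mdeg_le_eq => //; rewrite mdeg_mcat mdeg0 (deg_c d).
have c0W : mcat 0%MM c0 \in bases (pm_meet (mcat a b) D C).
  by apply: (mem_meet c0).2; exists d0.
by move=> c; apply: iff_trans (bases_deletel c0W c) (mem_meet c).
Qed.

End Correspondence.

(** * Supports of the symbol and of the image *)

Local Open Scope ring_scope.

Section Coefficients.
Variables (R : realType) (m n : nat).

Lemma in_xX (g : 'X_{1..m}) :
  in_x n ('X_[g] : {mpoly R[m]}) = 'X_[mcat g 0%MM].
Proof.
rewrite /in_x comp_mpolyX [RHS]mpolyXE_id big_split_ord /= [X in _ * X]big1.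
  by rewrite mulr1; apply: eq_bigr => i _; rewrite tnth_mktuple mcatE.
by move=> j _; rewrite mcatE mnm0E expr0.
Qed.

Lemma in_yX (h : 'X_{1..n}) :
  in_y m ('X_[h] : {mpoly R[n]}) = 'X_[mcat 0%MM h].
Proof.
rewrite /in_y comp_mpolyX [RHS]mpolyXE_id big_split_ord /= [X in X * _]big1.
  by rewrite mul1r; apply: eq_bigr => i _; rewrite tnth_mktuple mcatE.
by move=> j _; rewrite mcatE mnm0E expr0.
Qed.

Lemma mcoeff_sum_msupp k (p : {mpoly R[k]}) a :
  p@_a = \sum_(g <- msupp p) p@_g * (g == a)%:R.
Proof.
by rewrite {1}[p]mpolyE raddf_sum; apply: eq_bigr => g _; rewrite /= mcoeffZ mcoeffX.
Qed.

(** The two factors have no variable in common, so only one product of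
    monomials contributes to each coefficient. *)
Lemma mcoeff_in_yM_in_x (q : {mpoly R[n]}) (p : {mpoly R[m]}) a b :
  (in_y m q * in_x n p)@_(mcat a b) = q@_b * p@_a.
Proof.
rewrite {1}/in_y {1}/in_x !comp_mpolyEX big_distrlr /= raddf_sum /=.
rewrite (mcoeff_sum_msupp q b) (mcoeff_sum_msupp p a) big_distrlr /=.
apply: eq_bigr => h _; rewrite raddf_sum; apply: eq_bigr => g _ /=.
rewrite -[_ \mPo _]/(in_y m _) -['X_[g] \mPo _]/(in_x n _) in_xX in_yX.
rewrite -scalerAl -scalerAr !mcoeffZ -mpolyXD mcoeffX mcatD add0m addm0.
rewrite mulrACA mulrA -natrM mulnb; congr (_ * _%:R).
by congr nat_of_bool; apply/eqP/andP => [/mcat_inj[-> ->]|[/eqP-> /eqP->]].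
Qed.

Definition mfact_prod (g : 'X_{1..m}) : nat := (\prod_(i < m) (g i)`!)%N.

Lemma mfact_prod_gt0 g : (mfact_prod g)%:R > 0 :> R.
Proof. by rewrite ltr0n prodn_gt0 // => i; rewrite fact_gt0. Qed.

Lemma mcoeff_divpow g h : (divpow R g)@_h = (mfact_prod g)%:R^-1 * (g == h)%:R.
Proof. by rewrite mcoeffZ mcoeffX. Qed.

Variables (alpha : 'X_{1..m}) (beta : 'X_{1..n}).
Variable T : {linear mpoly_le R alpha -> mpoly_le R beta}.

Definition T_divpow g : {mpoly R[n]} :=
  T (insubd (0 : mpoly_le R alpha) (divpow R g)).

Lemma mcoeff_sym a b : (sym T)@_(mcat a b) =
  \sum_(g : 'X_{1..m < (mdeg alpha).+1} | (g <= alpha)%MM)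
    (T_divpow g)@_b * (divpow R (alpha - g)%MM)@_a.
Proof.
by rewrite /sym raddf_sum; apply: eq_bigr => g _; rewrite /= mcoeff_in_yM_in_x.
Qed.

(** Distinct [g] below [alpha] have distinct complements [alpha - g], so only one
    summand of the symbol contains the [x]-monomial of exponent [alpha - g]. *)
Lemma mcoeff_sym_sub g b : (g <= alpha)%MM ->
  (sym T)@_(mcat (alpha - g) b)
  = (T_divpow g)@_b * (mfact_prod (alpha - g)%MM)%:R^-1.
Proof.
move=> lega; have ltg : (mdeg g < (mdeg alpha).+1)%N.
  by rewrite -(submK lega) mdegD ltnS leq_addl.
rewrite mcoeff_sym (bigD1 (BMultinom ltg)) //= mcoeff_divpow eqxx mulr1.
rewrite big1 ?addr0 // => h /andP[leha neq_hg].
rewrite mcoeff_divpow; case: eqP => [eq_gh|_]; last by rewrite !mulr0.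
case/negP: neq_hg; apply/eqP/val_inj/mnmP=> i /=; move/mnmP/(_ i): eq_gh.
by rewrite !mnmBE; move/mnm_lepP/(_ i): lega; move/mnm_lepP/(_ i): leha; lia.
Qed.

Lemma msupp_sym_le e : e \in msupp (sym T) -> (e <= mcat alpha beta)%MM.
Proof.
rewrite -(mcatK e) mcoeff_msupp mcoeff_sym mcat_le; move: (mleft e) (mright e) => a b.
apply: contraR; rewrite negb_and => nle; apply/eqP/big1 => g lega.
have [/orP[]|] := boolP ((~~ (a <= alpha)%MM) || (~~ (b <= beta)%MM)).
- move=> nlea; rewrite mcoeff_divpow; case: eqP => [eqa|_]; last by rewrite !mulr0.
  by case/negP: nlea; rewrite -eqa lem_subr.
- move=> nleb; rewrite [_@_b]memN_msupp_eq0 ?mul0r //.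
  by apply: contra nleb; rewrite /T_divpow; case: (T _) => q /= /allP; apply.
by rewrite nle.
Qed.

Lemma mcoeff_image (f : mpoly_le R alpha) b :
  (mpoly_le_val (T f))@_b = \sum_(g <- msupp (mpoly_le_val f))
    (mpoly_le_val f)@_g * (mfact_prod g)%:R * (T_divpow g)@_b.
Proof.
have def_f : f = \sum_(g <- msupp (mpoly_le_val f))
    ((mpoly_le_val f)@_g * (mfact_prod g)%:R) *:
      insubd (0 : mpoly_le R alpha) (divpow R g).
  apply/val_inj; rewrite [RHS]raddf_sum /= {1}[mpoly_le_val f]mpolyE.
  apply: eq_big_seq => g gf /=.
  rewrite [RHS]linearZ /= val_insubd divpow_le; last first.
    by have /allP := mpoly_le_valP f; apply.
  by rewrite /divpow scalerA mulfK // gt_eqF ?mfact_prod_gt0.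
have valZ c x : mpoly_le_val (T (c *: x)) = c *: mpoly_le_val (T x).
  by rewrite linearZ.
transitivity ((\val (T f))@_b) => //; rewrite {1}def_f !raddf_sum.
by apply: eq_bigr => g _; rewrite -mcoeffZ -valZ.
Qed.

End Coefficients.

(** By the two coefficient formulas, the coefficient of [T f] at [c] is a sum over
    [d] in the support of [f] of positive multiples of the coefficients of
    [sym T] at [(alpha - d, c)]; a sum of nonnegative terms vanishes only if
    every term does. *)
Lemma msupp_image (R : realType) m n (alpha : 'X_{1..m}) (beta : 'X_{1..n})
    (T : {linear mpoly_le R alpha -> mpoly_le R beta}) (f : mpoly_le R alpha) :
  (forall g, 0 <= (mpoly_le_val f)@_g) -> (forall e, 0 <= (sym T)@_e) ->
  forall c, c \in msupp (mpoly_le_val (T f)) <->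
    exists2 d, d \in msupp (mpoly_le_val f)
             & mcat (alpha - d) c \in msupp (sym T).
Proof.
move=> f_ge0 sym_ge0 c.
have le_f d : d \in msupp (mpoly_le_val f) -> (d <= alpha)%MM.
  by have /allP := mpoly_le_valP f; apply.
have fact_gt0 (g : 'X_{1..m}) : 0 < (mfact_prod g)%:R :> R := mfact_prod_gt0 R g.
have T_def d : d \in msupp (mpoly_le_val f) ->
    (T_divpow T d)@_c =
    (sym T)@_(mcat (alpha - d) c) * (mfact_prod (alpha - d)%MM)%:R.
  by move=> df; rewrite mcoeff_sym_sub ?le_f // divfK // gt_eqF.
rewrite mcoeff_msupp mcoeff_image big_seq_cond psumr_neq0; last first.
  move=> d /andP[df _]; rewrite T_def // !mulr_ge0 ?f_ge0 ?sym_ge0 //; exact: ltW.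
split=> [/hasP[d df /andP[_ gt0]]|[d df dc]].
  exists d => //; rewrite mcoeff_msupp; apply: contraTneq gt0 => sym0.
  by rewrite T_def // sym0 mul0r mulr0 ltxx.
apply/hasP; exists d => //; rewrite df T_def //= !mulr_gt0 //.
  by rewrite lt_neqAle f_ge0 eq_sym -mcoeff_msupp df.
by rewrite lt_neqAle sym_ge0 eq_sym -mcoeff_msupp dc.
Qed.

Unset Implicit Arguments.

Theorem theorem7p3 (R : realType) (m n : nat)
    (alpha : 'X_{1..m}) (beta : 'X_{1..n})
    (T : {linear mpoly_le R alpha -> mpoly_le R beta})
    (f : mpoly_le R alpha)
    (P : polymatroid m) (Q : polymatroid n) (C : polymatroid (m + n)) :
  lorentzian (sym T) ->
  lorentzian (mpoly_le_val f) ->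
  T f != 0 ->
  bases P =i msupp (mpoly_le_val f) ->
  bases Q =i msupp (mpoly_le_val (T f)) ->
  bases C =i msupp (sym T) ->
  [/\ is_cage alpha P, is_cage beta Q, is_cage (mcat alpha beta) C,
      is_cage beta (correspondence C alpha beta P)
    & (Q, beta) = (correspondence C alpha beta P, beta)].
Proof.
move=> [_ [_ [_ sym_ge0 symM _]]] [_ [_ [_ f_ge0 fM _]]] Tf_neq0 PE QE CE.
have exP := exchange_M_convex PE fM; have exC := exchange_M_convex CE symM.
have leP d : d \in bases P -> (d <= alpha)%MM.
  by rewrite PE; have /allP := mpoly_le_valP f; apply.
have imP := msupp_image f_ge0 sym_ge0.
have cageQ : is_cage beta Q.
  by apply: cage_of_bases => d; rewrite QE; have /allP := mpoly_le_valP (T f); apply.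
have defQ : Q = correspondence C alpha beta P.
  have [c cTf] : exists c, c \in msupp (mpoly_le_val (T f)).
    have : mpoly_le_val (T f) != 0.
      by apply: contra_neq Tf_neq0 => Tf0; apply: val_inj.
    rewrite -msupp_eq0; case: msupp => // c s _; exists c; exact: mem_head.
  have [d df dc] := (imP c).1 cTf.
  have corrP := @bases_correspondence _ _ C P alpha beta exP exC leP.
  apply: bases_inj => x; rewrite QE; apply/idP/idP.
    move=> /imP[y yf yx]; apply/corrP; first by exists d, c; rewrite PE CE.
    by exists y; rewrite ?PE ?CE.
  move=> /corrP[|y]; first by exists d, c; rewrite PE CE.
  by rewrite PE CE => yf yx; apply/imP; exists y.
split=> //; last by rewrite defQ.
- exact: cage_of_bases.
- by apply: cage_of_bases => e; rewrite CE; apply: msupp_sym_le.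
- by rewrite -defQ.
Qed.
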